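(* Let $L\ge0$ and $k\ge1$ be integers and let $(b,c)$ be a weakly admissible pair of integers, i.e. $b-c\in\{-k,-k+2,\dots,k\}$. Then $$f^{(k)}_L(b,c)=\sum q^{\mathcal Q}\,{L \brack x_0\cdots x_k},$$ $$\mathcal Q=\frac{L^2k-L(b-c+k)+b}4-\sum_{0\le a\le a'\le k}(a'-a)x_ax_{a'}+\sum_{\frac{c-b+k}2\le a\le k}\Bigl(a-\frac{c-b+k}2\Bigr)x_a,$$ where the sum is taken over all non-negative integers $x_0,\dots,x_k$ satisfying $$\sum_{a=0}^k x_a=L,\qquad \sum_{a=0}^k a x_a=\frac{Lk-b}2 .$$
   Context: Fix an integer $k\ge1$. A pair of integers $(b,c)$ is weakly admissible if $b-c\in\{-k,-k+2,\dots,k\}$. The functions $f^{(k)}_L(b,c)$, Laurent polynomials in a fractional power ($q^{1/4}$) of an indeterminate $q$, are defined for weakly admissible $(b,c)$ and integers $L\ge0$ as the unique solution of $$f^{(k)}_0(b,c)=\delta_{b,0},\qquad f^{(k)}_L(b,c)=\sum_d f^{(k)}_{L-1}(d,b)\,q^{L|d-c|/4}\quad(L\ge1),$$ the sum being over all $d$ such that $(d,b)$ is weakly admissible; $f^{(k)}_L(b,c)=0$ if $(b,c)$ is not weakly admissible. With $(q)_m=\prod_{j=1}^m(1-q^j)$, the $q$-multinomial coefficient is ${M\brack m_1\cdots m_n}=\dfrac{(q)_M}{\prod_{j}(q)_{m_j}}$ if all $m_j$ are non-negative integers with $m_1+\cdots+m_n=M$, and $0$ otherwise. *)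

(* Defs.v *)
From HB Require Import structures.
From mathcomp Require Import all_boot all_order all_algebra.

Set Implicit Arguments.
Unset Strict Implicit.
Unset Printing Implicit Defensive.

Import Order.TTheory GRing.Theory Num.Theory.
Local Open Scope ring_scope.

(* Laurent polynomials in q^(1/4), and the quotients (q)_M / \prod_j (q)_(m_j), *)
(* live in the field of rational functions in the indeterminate q^(1/4).       *)
Definition ratfun : fieldType := {fraction {poly rat}}.

Definition q14 : ratfun := tofrac 'X.

Definition q : ratfun := q14 ^+ 4.

Definition qpoch (m : nat) : ratfun := \prod_(1 <= j < m.+1) (1 - q ^+ j).

Definition qmultinomial (M n : nat) (m : 'I_n -> nat) : ratfun :=
  if (\sum_(j < n) m j == M)%N then qpoch M / \prod_(j < n) qpoch (m j) else 0.

Definition steps (k : nat) : seq int :=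
  [seq - k%:Z + 2 * i%:Z | i <- iota 0 k.+1].

Definition weakly_admissible (k : nat) (b c : int) : bool := b - c \in steps k.

(* The integers d such that (d, b) is weakly admissible; see mem_predecessors *)
(* and uniq_predecessors.                                                     *)
Definition predecessors (k : nat) (b : int) : seq int :=
  [seq b + s | s <- steps k].

Fixpoint f (k L : nat) (b c : int) : ratfun :=
  if weakly_admissible k b c then
    match L with
    | 0 => (b == 0)%:R
    | L'.+1 =>
        \sum_(d <- predecessors k b) f k L' d b * q14 ^ (L'.+1%:Z * `|d - c|)
    end
  else 0.

Lemma mem_predecessors (k : nat) (b d : int) :
  (d \in predecessors k b) = weakly_admissible k d b.
Proof.
by rewrite /weakly_admissible -[RHS](mem_map (addrI b)) (addrC b) subrK.
Qed.

Lemma uniq_predecessors (k : nat) (b : int) : uniq (predecessors k b).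
Proof.
rewrite map_inj_uniq; last exact: addrI.
rewrite map_inj_uniq ?iota_uniq // => i j /addrI /mulfI.
by move=> /(_ isT) [].
Qed.

Lemma f_unique (k : nat) (g : nat -> int -> int -> ratfun) :
    (forall L b c, ~~ weakly_admissible k b c -> g L b c = 0) ->
    (forall b c, weakly_admissible k b c -> g 0%N b c = (b == 0)%:R) ->
    (forall L b c, weakly_admissible k b c -> g L.+1 b c =
       \sum_(d <- predecessors k b) g L d b * q14 ^ (L.+1%:Z * `|d - c|)) ->
  forall L b c, g L b c = f k L b c.
Proof.
move=> g_out g_0 g_S; elim=> [|L IH] b c /=.
  by case: ifPn => [/g_0 | /g_out].
case: ifPn => [bc | /g_out //]; rewrite g_S //.
by apply: eq_bigr => d _; rewrite IH.
Qed.

(* 4 times the exponent \mathcal Q, so that q ^ \mathcal Q is q14 ^ exponent4. *)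
(* The division by 2 is exact when (b, c) is weakly admissible.               *)
Definition exponent4 (k L : nat) (b c : int) (x : 'I_k.+1 -> nat) : int :=
  let h := ((c - b + k%:Z) %/ 2)%Z in
  (L%:Z ^+ 2 * k%:Z - L%:Z * (b - c + k%:Z) + b)
  + 4 * (- (\sum_(a < k.+1) \sum_(a' < k.+1 | (a <= a')%N)
              (a'%:Z - a%:Z) * (x a)%:Z * (x a')%:Z)
         + \sum_(a < k.+1 | h <= a%:Z) (a%:Z - h) * (x a)%:Z).

(* Main.v *)
Require Import Defs.
From HB Require Import structures.
From mathcomp Require Import all_boot all_order all_algebra.
From mathcomp Require Import zify ring.

Set Implicit Arguments.
Unset Strict Implicit.
Unset Printing Implicit Defensive.

Import Order.TTheory GRing.Theory Num.Theory.
Local Open Scope ring_scope.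

(* With N_t = x_t + ... + x_k one has                                         *)
(*   \sum_(a <= a') (a' - a) x_a x_a' = L \sum_t N_t - \sum_t N_t ^ 2,        *)
(* so that, for h = (c - b + k) / 2 and M = (L k - b) / 2, the right-hand     *)
(* side is a power of q times the coefficient of X ^ M in                     *)
(*   A_L(h; X) = \sum_(L >= N_1 >= ... >= N_k) X ^ (N_1 + ... + N_k)          *)
(*     q ^ (N_1 ^ 2 + ... + N_k ^ 2 + N_(h+1) + ... + N_k)                    *)
(*     [L; N_1] [N_1; N_2] ... [N_(k-1); N_k],                                *)
(* and the recursion defining f becomes                                       *)
(*   A_L(h; X) = \sum_a (q X) ^ a q ^ (L (a - h)^+) A_(L-1)(k - a; q X).      *)
(* Allow an arbitrary linear form v_1 N_1 + ... + v_k N_k in the exponent of  *)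
(* q. Moving one unit of v from position a + 1 to position a inserts a factor *)
(* 1 - q ^ (N_a - N_(a+1)), which is absorbed by the q-binomials and yields a *)
(* sum for L - 1 (ndiffE). Comparing two such moves leaves a linear relation  *)
(* between sums with the same L (ndiff_step), from which sum_ladder follows   *)
(* by telescoping; the recursion for A_L(h; X) is then obtained by induction  *)
(* on h, the case h = 0 being divided by 1 - q ^ L.                           *)

(** Both sides obey the same recursion in L. With c = b + 2h - k and b = L k - 2M, the predecessor d
    = b - k + 2a replaces (h, M) by (k - a, M - a), and |d - c| = 2|a - h|. Up to an explicit power
    of q, the recursion of f is therefore the one satisfied by the coefficient of X^M in A_L(h; X).
    That recursion is [nsum_rec], obtained from [ndiffE] and [sum_ladder]; [f_coef] transfers it to
    f by induction on L. Finally [qnsum_expand] writes the coefficient as a sum of q-multinomials,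
    and [exponent4E] matches the exponents. *)

Section NestedSums.

(** * Nested sums over a commutative ring and their recursion *)

Variables (A : comNzRingType) (q : A) (bin : nat -> nat -> A).

(* The sum over l = N_0 >= N_1 >= ... >= N_k of X ^ (N_1 + ... + N_k) times   *)
(* q ^ (\sum_(1 <= t <= k) N_t ^ 2 + \sum_(0 <= t <= k) v_t N_t) and the      *)
(* binomials bin N_t N_(t+1). The value of v at k + 1 is ignored, which       *)
(* matches the convention N_(k+1) = 0.                                        *)
Fixpoint nsum (k l : nat) (X : A) (v : nat -> nat) : A :=
  q ^+ (l * v 0%N) *
  match k with
  | 0 => 1
  | k'.+1 => \sum_(n < l.+1) X ^+ n * q ^+ (n * n) * bin l n
                             * nsum k' n X (fun i => v i.+1)
  end.

Lemma eq_nsum (k l : nat) (X : A) (v w : nat -> nat) :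
  (forall i, (i <= k)%N -> v i = w i) -> nsum k l X v = nsum k l X w.
Proof.
elim: k l v w => [|k IH] l v w vw /=; rewrite vw //; congr (_ * _).
by apply: eq_bigr => n _; congr (_ * _); apply: IH => i ik; exact: vw.
Qed.

Lemma nsum_add0 (k l m : nat) (X : A) (v : nat -> nat) :
  nsum k l X (fun i => m * (i == 0) + v i)%N = q ^+ (l * m) * nsum k l X v.
Proof.
case: k => [|k] /=; rewrite muln1 mulnDr exprD -!mulrA //.
do 2!congr (_ * _); apply: eq_bigr => n _; congr (_ * _).
by apply: eq_nsum => i _; lia.
Qed.

Lemma nsum_dilate (k l : nat) (X : A) (v : nat -> nat) :
  nsum k l X (fun i => v i + (0 < i))%N = nsum k l (q * X) v.
Proof.
elim: k l v => [|k IH] l v /=; rewrite addn0 //; congr (_ * _).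
apply: eq_bigr => n _; rewrite -IH.
have -> : nsum k n X (fun i => v i.+1 + (0 < i.+1))%N
    = nsum k n X (fun i => 1 * (i == 0) + (v i.+1 + (0 < i)))%N.
  by apply: eq_nsum => i _; lia.
by rewrite nsum_add0 muln1 exprMn; ring.
Qed.

Definition ndiff (k l a : nat) (X : A) (v : nat -> nat) : A :=
  nsum k l X (fun i => v i + (i == a.+1))%N
    - nsum k l X (fun i => v i + (i == a))%N.

Hypothesis bin_top : forall l n, (n <= l)%N ->
  (1 - q ^+ (l.+1 - n)) * bin l.+1 n = (1 - q ^+ l.+1) * bin l n.
Hypothesis bin_bot : forall l n,
  (1 - q ^+ n.+1) * bin l.+1 n.+1 = (1 - q ^+ l.+1) * bin l n.

(** Induction on a, peeling off N_1. For a = 0 < k the factor is 1 - q^(l - N_1), and [bin_top]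
    lowers l. For larger a induction yields 1 - q^(N_1), and [bin_bot] lowers l and N_1 together.
    Each of N_1, ..., N_a drops by one, and (N + 1)^2 = N^2 + 2N + 1 accounts for the entries 2 and
    for q^a. *)
Lemma ndiffE (k l a : nat) (X : A) (v : nat -> nat) : (a <= k)%N ->
  ndiff k l a X v = (1 - q ^+ l) * q ^+ (a + \sum_(t < a.+1) v t) * X ^+ a
    * nsum k l.-1 X (fun i => v i + (i == a.+1) + 2 * (0 < i <= a))%N.
Proof.
elim: a k l v => [|a IH] [|k] l v // ak.
- rewrite /ndiff big_ord1 /= !addn0.
  case: l => [|l]; first by rewrite /= !mul0n !expr0; ring.
  by rewrite /= add0n mulnDr !mulSn !muln1 !exprD expr0; ring.
- rewrite /ndiff big_ord1 /= !addn0.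
  have S1 n : nsum k n X (fun i => v i.+1 + (i.+1 == 1))%N
      = q ^+ n * nsum k n X (fun i => v i.+1).
    by rewrite -[n in q ^+ n]muln1 -nsum_add0; apply: eq_nsum => i _; lia.
  have S0 n : nsum k n X (fun i => v i.+1 + (i.+1 == 0))%N
      = nsum k n X (fun i => v i.+1) by apply: eq_nsum => i _; lia.
  under eq_bigr => n _ do rewrite S1.
  under [X in _ - _ * X]eq_bigr => n _ do rewrite S0.
  under [X in _ = _ * (_ * X)]eq_bigr => n _.
    rewrite [nsum _ _ _ _](_ : _ = q ^+ n * nsum k n X (fun i => v i.+1));
      last first.
      by rewrite -S1; apply: eq_nsum => i _; lia.
    over.
  case: l => [|l].
    by rewrite !mul0n !expr0 !big_ord1 /= !expr0; ring.
  pose T n := nsum k n X (fun i => v i.+1).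
  have key : \sum_(n < l.+2) X ^+ n * q ^+ (n * n) * bin l.+1 n * (q ^+ n * T n)
      - q ^+ l.+1 * \sum_(n < l.+2) X ^+ n * q ^+ (n * n) * bin l.+1 n * T n
    = (1 - q ^+ l.+1)
      * \sum_(n < l.+1) X ^+ n * q ^+ (n * n) * bin l n * (q ^+ n * T n).
    rewrite mulr_sumr -sumrB big_ord_recr /=.
    rewrite [X in _ + X = _](_ : _ = 0); last by ring.
    rewrite addr0 mulr_sumr; apply: eq_bigr => n _ /=.
    have le_nl : (n <= l)%N by rewrite -ltnS.
    transitivity (X ^+ n * q ^+ (n * n) * T n * q ^+ n
                  * ((1 - q ^+ (l.+1 - n)) * bin l.+1 n)).
      by rewrite -[in q ^+ l.+1](subnK (leqW le_nl)) exprD; ring.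
    by rewrite bin_top //; ring.
  rewrite mulnDr muln1 exprD -[X in _ - X]mulrA -mulrBr key.
  by rewrite /= add0n mulSn expr0 exprD; ring.
- rewrite /ndiff big_ord_recl /= !addn0.
  rewrite -mulrBr -sumrB.
  pose T n := nsum k n X (fun i => v i.+1 + (i == a.+1) + 2 * (0 < i <= a))%N.
  pose e := (a + \sum_(t < a.+1) v t.+1)%N.
  have key : \sum_(n < l.+1) (X ^+ n * q ^+ (n * n) * bin l n
        * nsum k n X (fun i => v i.+1 + (i.+1 == a.+2))%N
      - X ^+ n * q ^+ (n * n) * bin l n
        * nsum k n X (fun i => v i.+1 + (i.+1 == a.+1))%N)
    = (1 - q ^+ l) * q ^+ e.+1 * X ^+ a.+1
      * \sum_(n < l.-1.+1) X ^+ n * q ^+ (n * n) * bin l.-1 n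
          * (q ^+ (2 * n) * T n).
    under eq_bigr => n _.
      rewrite -mulrBr; have := IH k n (fun i => v i.+1) ak.
      rewrite /ndiff => ->.
      over.
    (* The term n = 0 vanishes through 1 - q^0, so n can be shifted by one. *)
    rewrite /= big_ord_recl /= expr0 subrr !(mul0r, mulr0) add0r.
    case: l => [|l]; first by rewrite big_ord0 subrr !mul0r.
    rewrite mulr_sumr; apply: eq_bigr => -[n n_lt] _ /=.
    rewrite /bump leq0n add1n /= -/e.
    rewrite -[nsum _ _ _ _]/(T n).
    transitivity (X ^+ n.+1 * q ^+ (n.+1 * n.+1) * q ^+ e * X ^+ a * T n
                  * ((1 - q ^+ n.+1) * bin l.+1 n.+1)); first by ring.
    rewrite bin_bot (_ : n.+1 * n.+1 = n * n + 2 * n + 1)%N; last by lia.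
    rewrite (exprD _ (_ + 2 * _)) (exprD _ (n * n)%N).
    by rewrite (exprS X) (exprS q e) (exprS X a); ring.
  rewrite key.
  rewrite [Y in _ = _ * (_ * Y)](eq_bigr (fun n : 'I_(l.-1.+1) =>
    X ^+ n * q ^+ (n * n) * bin l.-1 n * (q ^+ (2 * n) * T n))); last first.
    move=> n _; congr (_ * _); rewrite mulnC -nsum_add0.
    by apply: eq_nsum => i _; lia.
  rewrite addSn /= addnCA -/e.
  case: l key => [|l] _; first by rewrite expr0 subrr !(mul0r, mulr0).
  by rewrite /= mulSn (exprS q e) (exprS q (_ + e)) 2!(exprD q (v 0%N)); ring.
Qed.

Lemma ndiff_step (k l a : nat) (X : A) (v : nat -> nat) : (a < k)%N ->
  ndiff k l a.+1 X v = q ^+ (v a.+1).+1 * X *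
    ndiff k l a X (fun i => v i + (i == a.+1) + (i == a.+2))%N.
Proof.
move=> ak; rewrite !ndiffE // 1?ltnW // big_ord_recr /=.
rewrite [in RHS](eq_bigr (fun t : 'I_a.+1 => v t)); last first.
  by move=> t _; have := ltn_ord t; lia.
rewrite [in RHS](@eq_nsum _ _ _ _
  (fun i => v i + (i == a.+2) + 2 * (0 < i <= a.+1))%N).
  by rewrite !addSn !exprS !exprD; ring.
by move=> i _; lia.
Qed.

Definition block_diff (k l h m : nat) (X : A) (v : nat -> nat) : A :=
  nsum k l X (fun i => v i + (m < i <= m + h.+1))%N
    - nsum k l X (fun i => v i + (m <= i <= m + h))%N.

(* Moving the entries of a block of ones one at a time, leftmost first, gives *)
(* moves to which ndiff_step applies with v a.+1 = 0.                         *)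
Lemma block_diff_step (k l h m : nat) (X : A) (v : nat -> nat) :
    (m + h < k)%N ->
    (forall i, (i <= m.+1 + h)%N -> v i = 0%N) ->
  block_diff k l h m.+1 X v = q * X *
    block_diff k l h m X (fun i => v i + (i == m.+1 + h) + (i == m.+2 + h))%N.
Proof.
move=> mhk v0.
(* In [g j] the block on [m+1, m+h+2] has its gap at m+1+j; [V] is the block without a gap, to which
   one extra unit is added at m+j. *)
pose V i := (v i + (m < i <= m + h.+2))%N.
pose g j := nsum k l X (fun i => v i + (m.+1 <= i < m.+1 + j)
                              + (m.+1 + j < i <= m + h.+2))%N.
have -> : block_diff k l h m.+1 X v = - (\sum_(0 <= j < h.+1) (g j.+1 - g j)).
  rewrite telescope_sumr // opprB; congr (_ - _); apply: eq_nsum => i _; lia.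
have -> : block_diff k l h m X
      (fun i => v i + (i == m.+1 + h) + (i == m.+2 + h))%N
    = \sum_(0 <= j < h.+1) ndiff k l (m + j) X V.
  transitivity (\sum_(0 <= j < h.+1)
      (nsum k l X (fun i => V i + (i == m + j.+1))%N
         - nsum k l X (fun i => V i + (i == m + j))%N)).
    rewrite (telescope_sumr
      (fun j => nsum k l X (fun i => V i + (i == m + j))%N)) //.
    by congr (_ - _); apply: eq_nsum => i _; rewrite /V; lia.
  by apply: eq_bigr => j _; rewrite /ndiff addnS.
rewrite mulr_sumr -sumrN !big_mkord; apply: eq_bigr => j _.
have jh := ltn_ord j; have jk : (m + j < k)%N by lia.
pose u i := (v i + (m.+1 <= i < m.+1 + j) + (m.+2 + j < i <= m + h.+2))%N.
have -> : ndiff k l (m + j) X V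
  = ndiff k l (m + j) X
      (fun i => u i + (i == (m + j).+1) + (i == (m + j).+2))%N.
  by congr (_ - _); apply: eq_nsum => i _; rewrite /V /u; lia.
have u0 : u (m + j).+1 = 0%N by rewrite /u v0; lia.
have := ndiff_step l X u jk; rewrite u0 expr1 => <-.
by rewrite opprB; congr (_ - _); apply: eq_nsum => i _; rewrite /u; lia.
Qed.

(** Each application of [block_diff_step] adds ones only beyond the shifted block, so the vanishing
    hypothesis persists until the block starts at 0. *)
Lemma block_diff_iter (k l h m : nat) (X : A) (v : nat -> nat) :
    (m + h <= k)%N ->
    (forall i, (i <= m + h)%N -> v i = 0%N) ->
  block_diff k l h m X v = (q * X) ^+ m *
    block_diff k l h 0 X
      (fun i => v i + (h < i <= m + h) + (h.+1 < i <= m.+1 + h))%N.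
Proof.
elim: m v => [|m IH] v mhk v0.
  by rewrite mul1r; congr (_ - _); apply: eq_nsum => i _; lia.
rewrite block_diff_step // IH; [|lia|by move=> i im; rewrite v0; lia].
rewrite exprS -[RHS]mulrA; do 2!congr (_ * _).
by congr (_ - _); apply: eq_nsum => i _; lia.
Qed.

(** Induction on n: on the right, the terms i > 0 for n + 1 are q X q^l times the whole sum for n.
    After the induction hypothesis the termwise differences are block differences, and they
    telescope. *)
Lemma sum_ladder (k l n : nat) (X : A) : (n <= k)%N ->
  \sum_(i < n.+1) (q * X) ^+ i
     * nsum k l X (fun j => (0 < j <= k - n) + 2 * (k - n < j <= k - n + i)
                         + (j == (k - n + i).+1))%N
  = \sum_(i < n.+1) (q * X) ^+ i * q ^+ (l * i)
     * nsum k l X (fun j => n - i < j <= k)%N.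
Proof.
elim: n => [|n IH] nk.
  rewrite !big_ord1 muln0 expr0 !mul1r; apply: eq_nsum => i; lia.
have {}IH := IH (ltnW nk).
rewrite big_ord_recl [in RHS]big_ord_recl /= muln0 expr0 !mul1r.
have -> : \sum_(i < n.+1) (q * X) ^+ bump 0 i * q ^+ (l * bump 0 i)
     * nsum k l X (fun j => n.+1 - bump 0 i < j <= k)%N
   = q * X * q ^+ l * \sum_(i < n.+1) (q * X) ^+ i * q ^+ (l * i)
     * nsum k l X (fun j => n - i < j <= k)%N.
  rewrite mulr_sumr; apply: eq_bigr => i _.
  by rewrite /bump leq0n add1n subSS mulnS !exprS exprD; ring.
rewrite -IH.
set h := (k - n.+1)%N; have -> : (k - n = h.+1)%N by rewrite /h; lia.
apply/eqP; rewrite -subr_eq0 mulr_sumr opprD addrACA -sumrB.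
pose g m := nsum k l X (fun j => m < j <= m + h.+1)%N.
have -> : \sum_(i < n.+1)
    ((q * X) ^+ bump 0 i
       * nsum k l X (fun j => (0 < j <= h) + 2 * (h < j <= h + bump 0 i)
                           + (j == (h + bump 0 i).+1))%N
     - q * X * q ^+ l * ((q * X) ^+ i
       * nsum k l X (fun j => (0 < j <= h.+1) + 2 * (h.+1 < j <= h.+1 + i)
                           + (j == (h.+1 + i).+1))%N))
    = \sum_(0 <= m < n.+1) (g m.+1 - g m).
  rewrite big_mkord; apply: eq_bigr => i _; have iN := ltn_ord i.
  have -> : g i.+1 - g i = block_diff k l h i.+1 X (fun=> 0%N).
    by congr (_ - _); apply: eq_nsum => j _; lia.
  rewrite block_diff_iter //; last by rewrite /h; lia.
  rewrite /block_diff mulrBr /bump leq0n add1n; congr (_ - _).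
    by congr (_ * _); apply: eq_nsum => j _; lia.
  rewrite (_ : nsum _ _ _ (fun i0 => _ + (0 <= i0 <= 0 + h))%N = q ^+ l *
     nsum k l X (fun j => (0 < j <= h.+1) + 2 * (h.+1 < j <= h.+1 + i)
                           + (j == (h.+1 + i).+1))%N).
    by rewrite exprS; ring.
  by rewrite -[l in q ^+ l]muln1 -nsum_add0; apply: eq_nsum => j _; lia.
rewrite telescope_sumr //; apply/eqP.
rewrite [Y in Y - _ + _](_ : _ = g 0%N); last by apply: eq_nsum => j _; lia.
rewrite [Y in _ - Y + _](_ : _ = g n.+1); first by ring.
(* The block of [g n.+1] ends at k + 1, where entries are ignored. *)
by apply: eq_nsum => j jk; rewrite /h; lia.
Qed.

(** Move the extra unit from position h one step at a time to k + 1, where it is ignored. The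
    resulting sums for l - 1 are collected by [sum_ladder] at q X. *)
Lemma nsum_diff (k l h : nat) (X : A) : (h <= k)%N ->
  nsum k l X (fun j => h < j <= k)%N
    - nsum k l X (fun j => (h < j <= k) + (j == h))%N
  = (1 - q ^+ l) * \sum_(h <= a < k.+1) (q * X) ^+ a * q ^+ (l * (a - h))
       * nsum k l.-1 (q * X) (fun j => k - a < j <= k)%N.
Proof.
move=> hk; set u := (fun j => h < j <= k : nat)%N.
pose g j := nsum k l X (fun i => u i + (i == j))%N.
have -> : nsum k l X (fun j => h < j <= k)%N
    - nsum k l X (fun j => (h < j <= k) + (j == h))%N
  = \sum_(h <= a < k.+1) ndiff k l a X u.
  rewrite (telescope_sumr g) ?(leqW hk) //; congr (_ - _).
  by apply: eq_nsum => j jk; rewrite /u; lia.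
pose n := (k - h)%N.
have shift (F : nat -> A) :
    \sum_(h <= a < k.+1) F a = \sum_(i < n.+1) F (i + h)%N.
  by rewrite -{1}[h]add0n big_addn big_mkord subSn.
rewrite !shift.
transitivity ((1 - q ^+ l) * (q * X) ^+ h * \sum_(i < n.+1) (q * (q * X)) ^+ i
     * nsum k l.-1 (q * X) (fun j => (0 < j <= k - n)
         + 2 * (k - n < j <= k - n + i) + (j == (k - n + i).+1))%N); last first.
  rewrite sum_ladder ?leq_subr // -mulrA.
  clear g; case: l => [|l]; first by rewrite expr0 subrr !mul0r.
  congr (_ * _); rewrite mulr_sumr; apply: eq_bigr => -[i /= i_lt] _.
  rewrite addnK addnC (_ : (k - (h + i) = n - i)%N); last by rewrite /n; lia.
  by rewrite mulSn !exprD !exprMn; ring.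
rewrite mulr_sumr; apply: eq_bigr => -[i /= i_lt] _.
rewrite ndiffE; last by rewrite /n in i_lt; lia.
have -> : (\sum_(t < (i + h).+1) u t = i)%N.
  rewrite -(big_mkord xpredT u).
  rewrite (big_cat_nat _ (n := h.+1)) //= ?ltnS ?leq_addl //.
  rewrite big_nat big1 => [|t th]; last by rewrite /u; lia.
  rewrite add0n (eq_big_nat _ _ (F2 := fun=> 1%N)) => [|t th].
    by rewrite sum_nat_const_nat; lia.
  by rewrite /n in i_lt; rewrite /u; lia.
rewrite -nsum_dilate /n subKn // -/n.
rewrite (_ : nsum _ _ _ _ = nsum k l.-1 X (fun j => (0 < j <= h)
  + 2 * (h < j <= h + i) + (j == (h + i).+1) + (0 < j))%N).
  by rewrite !exprD !exprMn; ring.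
by apply: eq_nsum => j jk; rewrite /u; lia.
Qed.

Lemma nsum_rec (k l h : nat) (X : A) : (h <= k)%N ->
  GRing.lreg (1 - q ^+ l) ->
  nsum k l X (fun j => h < j <= k)%N
  = \sum_(a < k.+1) (q * X) ^+ a * q ^+ (l * (a - h))
       * nsum k l.-1 (q * X) (fun j => k - a < j <= k)%N.
Proof.
move=> hk reg.
pose T a := nsum k l.-1 (q * X) (fun j => k - a < j <= k)%N.
elim: h hk => [|h IH] hk.
  apply: reg; have := nsum_diff l X hk; rewrite big_mkord => E.
  rewrite (eq_bigr
    (fun a : 'I_k.+1 => (q * X) ^+ a * q ^+ (l * (a - 0)) * T a)) // -E.
  rewrite mulrBl mul1r; congr (_ - _).
  (* For h = 0 the extra unit sits at position 0 and only contributes q^l. *)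
  rewrite -[l in q ^+ l]muln1 -nsum_add0; apply: eq_nsum => j _; lia.
have := nsum_diff l X hk; rewrite (_ : nsum k l X (fun j => _ + (j == h.+1))%N
    = nsum k l X (fun j => h < j <= k)%N); last by apply: eq_nsum => j _; lia.
rewrite IH; last exact: ltnW.
move/eqP; rewrite subr_eq => /eqP ->; rewrite mulr_sumr.
pose G e a := (q * X) ^+ a * q ^+ (l * (a - e)) * T a.
rewrite -(big_mkord xpredT (G h)) -(big_mkord xpredT (G h.+1)).
have hk1 : (h.+1 <= k.+1)%N := leqW hk.
rewrite (big_cat_nat _ (m := 0%N) (n := h.+1) (p := k.+1)) //=.
rewrite [in RHS](big_cat_nat _ (m := 0%N) (n := h.+1) (p := k.+1)) //=.
rewrite addrCA -big_split /=; congr (_ + _); apply: eq_big_nat => a ha.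
  by congr (_ * _ ^+ (_ * _) * _); lia.
rewrite /G (_ : a - h = (a - h.+1).+1)%N; last by lia.
by rewrite mulnS exprD /T; ring.
Qed.
End NestedSums.

(** * Finite functions split at the first entry, and their tail sums *)

Definition fcons (T : finType) (n : nat) (t : T) (y : {ffun 'I_n -> T}) :
    {ffun 'I_n.+1 -> T} :=
  [ffun i => oapp y t (unlift ord0 i)].

Lemma fcons0 (T : finType) (n : nat) (t : T) (y : {ffun 'I_n -> T}) :
  fcons t y ord0 = t.
Proof. by rewrite ffunE unlift_none. Qed.

Lemma fconsS (T : finType) (n : nat) (t : T) (y : {ffun 'I_n -> T}) (i : 'I_n) :
  fcons t y (lift ord0 i) = y i.
Proof. by rewrite ffunE liftK. Qed.

Lemma big_fcons (R : nmodType) (T : finType) (n : nat)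
    (P : pred {ffun 'I_n.+1 -> T}) (F : {ffun 'I_n.+1 -> T} -> R) :
  \sum_(x | P x) F x = \sum_t \sum_(y | P (fcons t y)) F (fcons t y).
Proof.
rewrite pair_big_dep /=.
rewrite (reindex (fun p : T * {ffun 'I_n -> T} => fcons p.1 p.2)) //.
exists (fun x : {ffun 'I_n.+1 -> T} =>
  (x ord0, [ffun i : 'I_n => x (lift ord0 i)])) => [[t y] _ | x _] /=.
  by rewrite fcons0; congr pair; apply/ffunP => i; rewrite ffunE fconsS.
apply/ffunP => i; case: (unliftP ord0 i) => [j ->|->].
  by rewrite fconsS ffunE.
by rewrite fcons0.
Qed.

(* tail x t is N_t. *)
Definition tail (k : nat) (x : 'I_k -> nat) (t : nat) : nat :=
  (\sum_(i < k | t <= i) x i)%N.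

Definition weight (k : nat) (v : nat -> nat) (x : 'I_k.+1 -> nat) : nat :=
  (\sum_(t < k.+1) (v t * tail x t + (0 < t) * tail x t ^ 2))%N.

Lemma tail0 (k : nat) (x : 'I_k -> nat) : tail x 0 = (\sum_(i < k) x i)%N.
Proof. by apply: eq_bigl => i. Qed.

Lemma tailS (k : nat) (x : 'I_k.+1 -> nat) (t : nat) :
  tail x t.+1 = tail (fun i => x (lift ord0 i)) t.
Proof.
rewrite /tail big_mkcond big_ord_recl /= add0n [RHS]big_mkcond /=.
by apply: eq_bigr => i _; rewrite /bump leq0n add1n ltnS.
Qed.

Lemma weight_cons (k : nat) (v : nat -> nat) (x : 'I_k.+2 -> nat) :
  weight v x = (v 0 * tail x 0 + tail x 1 ^ 2
                + weight (fun i => v i.+1) (fun i => x (lift ord0 i)))%N.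
Proof.
rewrite /weight big_ord_recl mul0n addn0 -addnA; congr (_ + _)%N.
rewrite big_ord_recl [in RHS]big_ord_recl /= /bump !leq0n !add1n mul1n mul0n.
rewrite !tailS addn0 addnA (addnC (v 1 * _)%N); congr (_ + _)%N.
by apply: eq_bigr => i _; rewrite tailS /bump leq0n.
Qed.

(** * Coefficients of the nested sums as q-multinomial sums *)

Section Expansion.

Variables (F : fieldType) (q : F).
Hypothesis oneB_neq0 : forall n, 1 - q ^+ n.+1 != 0.

Definition qfact (m : nat) : F := \prod_(1 <= j < m.+1) (1 - q ^+ j).

Lemma qfactS (n : nat) : qfact n.+1 = qfact n * (1 - q ^+ n.+1).
Proof. by rewrite /qfact big_nat_recr. Qed.

Lemma qfact_neq0 (n : nat) : qfact n != 0.
Proof.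
elim: n => [|n IH]; first by rewrite /qfact big_geq ?oner_neq0.
by rewrite qfactS mulf_neq0.
Qed.

Definition qbin (l n : nat) : F := qfact l / (qfact n * qfact (l - n)).

Lemma qbin_top (l n : nat) : (n <= l)%N ->
  (1 - q ^+ (l.+1 - n)) * qbin l.+1 n = (1 - q ^+ l.+1) * qbin l n.
Proof.
move=> le_nl; rewrite /qbin subSn // !qfactS.
have := (qfact_neq0 n, qfact_neq0 (l - n), oneB_neq0 (l - n)).
by move=> [[? ?] ?]; field; apply/and3P.
Qed.

Lemma qbin_bot (l n : nat) :
  (1 - q ^+ n.+1) * qbin l.+1 n.+1 = (1 - q ^+ l.+1) * qbin l n.
Proof.
rewrite /qbin subSS !qfactS.
have := (qfact_neq0 n, qfact_neq0 (l - n), oneB_neq0 n).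
by move=> [[? ?] ?]; field; apply/and3P.
Qed.

Definition qnsum k l X v := nsum q%:P (fun l n => (qbin l n)%:P) k l X v.

(** Put x_t = N_t - N_(t+1): the product of q-binomials collapses to a q-multinomial. The bound B is
    separate from l so that the type of x survives the induction, which replaces l by N_1. *)
Lemma qnsum_expand (k l B : nat) (v : nat -> nat) : (l <= B)%N ->
  qnsum k l 'X v =
  \sum_(x : {ffun 'I_k.+1 -> 'I_B.+1} | (\sum_(a < k.+1) x a == l)%N)
    (q ^+ weight v (fun a => x a) * (qfact l / \prod_(a < k.+1) qfact (x a)))
      *: 'X^(\sum_(a < k.+1) a * x a)%N.
Proof.
rewrite /qnsum; elim: k l v => [|k IH] l v lB.
  rewrite (big_pred1 [ffun=> inord l]) => [|x]; last first.
    rewrite big_ord1; apply/eqP/eqP => [xl|->]; last first.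
      by rewrite ffunE inordK.
    by apply/ffunP => i; apply/val_inj; rewrite ffunE /= inordK // ord1.
  rewrite /= /weight !big_ord1 ffunE inordK // mul0n addn0 tail0 big_ord1.
  rewrite ffunE inordK // mul0n expr0 alg_polyC divff ?qfact_neq0 // !mulr1.
  by rewrite mulnC polyC_exp.
rewrite big_fcons [RHS](exchange_big_dep xpredT) //= mulr_sumr.
rewrite (eq_bigr (fun n : 'I_l.+1 =>
  \sum_(y : {ffun 'I_k.+1 -> 'I_B.+1} | (\sum_(a < k.+1) y a == n)%N)
   (q ^+ (l * v 0%N + n ^ 2 + weight (fun i => v i.+1) (fun a => y a)) *
     (qfact l / (qfact (l - n) * \prod_(a < k.+1) qfact (y a))))
     *: 'X^(n + \sum_(a < k.+1) a * y a)%N)); last first.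
  move=> n _; rewrite IH; last by have := ltn_ord n; lia.
  rewrite !mulr_sumr; apply: eq_bigr => y _.
  have Pi_neq0 : \prod_(a < k.+1) qfact (y a) != 0.
    by apply/prodf_neq0 => a _; exact: qfact_neq0.
  rewrite -!mul_polyC -!polyC_exp.
  rewrite [Y in _ = Y%:P * _](_ : _ = q ^+ (l * v 0%N) * q ^+ (n * n) * qbin l n
    * (q ^+ weight (fun i => v i.+1) (fun a => y a)
       * (qfact n / \prod_(a < k.+1) qfact (y a)))); last first.
    rewrite /qbin -mulnn !exprD.
    by field; rewrite Pi_neq0 !qfact_neq0.
  by rewrite !polyCM exprD; ring.
rewrite (exchange_big_dep xpredT) //=; apply: eq_bigr => y _.
have sum_fcons t : (\sum_(a < k.+2) fcons t y a = t + \sum_(a < k.+1) y a)%N.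
  rewrite big_ord_recl fcons0; congr (_ + _)%N.
  by apply: eq_bigr => a _; rewrite fconsS.
have [yl|ly] := leqP (\sum_(a < k.+1) y a)%N l; last first.
  rewrite big_pred0 => [|t]; last first.
    by apply/eqP => yt; move: ly; rewrite yt ltnNge -ltnS ltn_ord.
  by rewrite [RHS]big_pred0 // => t; rewrite sum_fcons; lia.
have n_lt : (\sum_(a < k.+1) y a < l.+1)%N by [].
rewrite (big_pred1 (Ordinal n_lt)) => [|n]; last first.
  by rewrite /= -val_eqE /= eq_sym.
have t_lt : (l - \sum_(a < k.+1) y a < B.+1)%N by lia.
rewrite (big_pred1 (Ordinal t_lt)) => [|t]; last first.
  rewrite /= sum_fcons -val_eqE /=.
  by rewrite -[RHS](eqn_add2r (\sum_(a < k.+1) y a)%N) subnK.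
have sum_fun : (\sum_(i < k.+1) (fcons (Ordinal t_lt) y) (lift ord0 i)
   = \sum_(i < k.+1) y i)%N by apply: eq_bigr => i _; rewrite fconsS.
congr (_ * (_ / _) *: 'X^_).
- rewrite weight_cons tailS !tail0 sum_fcons sum_fun /= subnK // (mulnC l).
  congr (_ ^+ (_ + _)%N); apply: eq_bigr => t _.
  have tl : tail (fun i => (fcons (Ordinal t_lt) y) (lift ord0 i) : nat) t
     = tail (fun i => y i : nat) t by apply: eq_bigr => i _; rewrite fconsS.
  by rewrite tl.
- rewrite [RHS]big_ord_recl fcons0; congr (_ * _).
  by apply: eq_bigr => i _; rewrite fconsS.
- rewrite [RHS]big_ord_recl mul0n add0n /= -big_split /=.
  by apply: eq_bigr => i _; rewrite fconsS /bump leq0n.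
Qed.

Lemma coef_qnsum_scale (k l n : nat) (v : nat -> nat) :
  (qnsum k l (q%:P * 'X) v)`_n = q ^+ n * (qnsum k l 'X v)`_n.
Proof.
rewrite /qnsum; elim: k l n v => [|k IH] l n v /=.
  rewrite mulr1 -polyC_exp coefC; case: eqP => [->|_]; last by rewrite mulr0.
  by rewrite expr0 mul1r.
rewrite -polyC_exp !coefCM mulrCA; congr (_ * _).
rewrite !coef_sum mulr_sumr; apply: eq_bigr => m _.
rewrite exprMn -!polyC_exp.
set u := nsum _ _ _ _ _ _; set w := nsum _ _ _ _ _ _.
transitivity (('X^m * ((q ^+ m * q ^+ (m * m) * qbin l m)%:P * u))`_n).
  by congr (polyseq _)`__; rewrite !polyCM; ring.
transitivity (q ^+ n * ('X^m * ((q ^+ (m * m) * qbin l m)%:P * w))`_n);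
  last first.
  by congr (_ * (polyseq _)`__); rewrite !polyCM; ring.
rewrite !coefXnM; case: ltnP => [|mn]; first by rewrite mulr0.
have -> : q ^+ n = q ^+ m * q ^+ (n - m) by rewrite -exprD subnKC.
by rewrite !coefCM IH; ring.
Qed.

Lemma qnsum_l0 (k : nat) (X : {poly F}) (v : nat -> nat) : qnsum k 0 X v = 1.
Proof.
rewrite /qnsum; elim: k v => [|k IH] v /=; first by rewrite mulr1.
rewrite big_ord1 IH /qbin /qfact big_geq // !mulr1 invr1 !expr0.
by rewrite !mul1r.
Qed.

Lemma coef_qnsum_rec (k l h n : nat) : (h <= k)%N ->
  (qnsum k l.+1 'X (fun j => h < j <= k)%N)`_n
  = \sum_(a < k.+1 | (a <= n)%N) q ^+ (n + l.+1 * (a - h))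
      * (qnsum k l 'X (fun j => k - a < j <= k)%N)`_(n - a).
Proof.
move=> hk; rewrite /qnsum nsum_rec //; first last.
- move=> x y; apply: mulfI.
  by rewrite -polyC_exp -polyC1 -polyCB polyC_eq0.
- by move=> l' n'; rewrite -!polyC_exp -polyC1 -!polyCB -!polyCM qbin_bot.
- by move=> l' n' ?; rewrite -!polyC_exp -polyC1 -!polyCB -!polyCM qbin_top.
rewrite coef_sum [RHS]big_mkcond /=; apply: eq_bigr => a _.
rewrite exprMn -!polyC_exp -!mulrA coefCM coefXnM.
case: leqP => [an|]; last by rewrite mulr0.
have -> : q ^+ (n + l.+1 * (a - h))
    = q ^+ a * q ^+ (n - a) * q ^+ (l.+1 * (a - h)).
  by rewrite -!exprD subnKC.
rewrite coefCM -/(qnsum _ _ _ _) coef_qnsum_scale.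
by rewrite /=; ring.
Qed.

End Expansion.

(** * The quadratic exponent in terms of tail sums *)

Lemma Posz_sum (I : Type) (r : seq I) (P : pred I) (F : I -> nat) :
  (\sum_(i <- r | P i) F i)%N%:Z = \sum_(i <- r | P i) (F i)%:Z.
Proof. exact: (big_morph Posz PoszD). Qed.

Lemma sum_between (k h : nat) (a : 'I_k.+1) :
  \sum_(t < k.+1) ((h < t) && (t <= a))%N%:Z = (a - h)%N%:Z.
Proof.
have count n m : (\sum_(t < n) ((h < t) && (t <= m)) = minn n.-1 m - h)%N.
  elim: n => [|n IH]; first by rewrite big_ord0 min0n.
  by rewrite big_ord_recr /= IH; lia.
have ak : (a <= k)%N by rewrite -ltnS.
by rewrite -Posz_sum count /= (minn_idPr ak).
Qed.

Lemma sum_tail (k h : nat) (x : 'I_k.+1 -> nat) :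
  \sum_(t < k.+1) (h < t)%N%:Z * (tail x t)%:Z
  = \sum_(a < k.+1 | (h <= a)%N) (a%:Z - h%:Z) * (x a)%:Z.
Proof.
transitivity (\sum_(t < k.+1) \sum_(a < k.+1)
    ((h < t) && (t <= a))%N%:Z * (x a)%:Z).
  apply: eq_bigr => t _; rewrite /tail Posz_sum mulr_sumr [LHS]big_mkcond /=.
  by apply: eq_bigr => a _; case: (t <= a)%N; rewrite ?andbT ?andbF ?mul0r.
rewrite big_mkcond exchange_big /= [RHS]big_mkcond; apply: eq_bigr => a _ /=.
rewrite -mulr_suml sum_between.
case: leqP => ha; first by rewrite subzn.
by rewrite (eqP (ltnW ha)) mul0r.
Qed.

(** Since a' - a counts the t with a < t <= a', the sum equals that of (N_0 - N_t) N_t over t. *)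
Lemma sum_pairs (k : nat) (x : 'I_k.+1 -> nat) :
  \sum_(a < k.+1) \sum_(a' < k.+1 | (a <= a')%N)
     (a'%:Z - a%:Z) * (x a)%:Z * (x a')%:Z
  = (tail x 0)%:Z * (\sum_(a < k.+1) a * x a)%N%:Z
    - \sum_(t < k.+1) (0 < t)%N%:Z * (tail x t)%:Z ^+ 2.
Proof.
transitivity (\sum_(t < k.+1)
    (\sum_(a < k.+1 | (a < t)%N) (x a)%:Z) * (tail x t)%:Z).
  transitivity (\sum_(a < k.+1) \sum_(a' < k.+1) \sum_(t < k.+1)
      ((a < t) && (t <= a'))%N%:Z * ((x a)%:Z * (x a')%:Z)).
    apply: eq_bigr => a _; rewrite big_mkcond; apply: eq_bigr => a' _ /=.
    rewrite -mulr_suml sum_between -mulrA.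
    case: leqP => aa'; first by rewrite subzn.
    by rewrite (eqP (ltnW aa')) mul0r.
  under eq_bigr => a _ do rewrite exchange_big.
  rewrite exchange_big; apply: eq_bigr => t _ /=.
  rewrite /tail Posz_sum big_distrlr /= [RHS]big_mkcond.
  apply: eq_bigr => a _ /=; case: ifP => [at_|_]; last first.
    by rewrite big1 // => a' _; rewrite mul0r.
  rewrite [RHS]big_mkcond; apply: eq_bigr => a' _ /=.
  by case: ifP; rewrite ?mul1r ?mul0r.
have -> : (\sum_(a < k.+1) a * x a)%N%:Z
    = \sum_(t < k.+1) (0 < t)%N%:Z * (tail x t)%:Z.
  rewrite sum_tail Posz_sum; apply: eq_bigr => a _.
  by rewrite subr0 PoszM.
rewrite mulr_sumr -sumrB; apply: eq_bigr => t _.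
have E : (tail x 0)%:Z = \sum_(a < k.+1 | (a < t)%N) (x a)%:Z + (tail x t)%:Z.
  rewrite /tail !Posz_sum (bigID (fun a : 'I_k.+1 => (a < t)%N)) /=.
  by congr (_ + _); apply: eq_bigl => a; rewrite -leqNgt.
rewrite E; case: (posnP t) => [t0|_]; last by rewrite /= !mul1r; ring.
by rewrite t0 big_pred0 //= !(mul0r, mulr0) subrr.
Qed.

Lemma exponent4E (k L h : nat) (b c : int) (x : 'I_k.+1 -> nat) :
  c - b + k%:Z = 2 * h%:Z ->
  (\sum_(a < k.+1) x a = L)%N ->
  2 * (\sum_(a < k.+1) a * x a)%N%:Z = L%:Z * k%:Z - b ->
  exponent4 L b c x
  = L%:Z ^+ 2 * k%:Z - L%:Z * k%:Z + 2 * L%:Z * h%:Z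
    - 2 * (\sum_(a < k.+1) a * x a)%N%:Z
    - 4 * L%:Z * (\sum_(a < k.+1) a * x a)%N%:Z
    + 4 * (weight (fun j => h < j <= k)%N x)%:Z.
Proof.
move=> hE xL M.
have weightE : (weight (fun j => h < j <= k)%N x)%:Z
    = \sum_(t < k.+1) (h < t)%N%:Z * (tail x t)%:Z
      + \sum_(t < k.+1) (0 < t)%N%:Z * (tail x t)%:Z ^+ 2.
  rewrite -big_split /weight Posz_sum; apply: eq_bigr => t _ /=.
  rewrite PoszD !PoszM (_ : h < t <= k = (h < t))%N; first by [].
  by rewrite -(ltnS t) ltn_ord andbT.
rewrite weightE sum_tail /exponent4 hE mulKz // sum_pairs tail0 xL.
rewrite (_ : b - c + k%:Z = 2 * k%:Z - 2 * h%:Z); last by lia.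
rewrite (_ : b = L%:Z * k%:Z - 2 * (\sum_(a < k.+1) a * x a)%N%:Z); last by lia.
by ring.
Qed.

(** * Identification of f with coefficients of nested sums *)

Lemma oneB_q_neq0 (n : nat) : 1 - q ^+ n.+1 != 0.
Proof.
rewrite /q /q14 -exprM -rmorphXn -(rmorph1 (@tofrac {poly rat})) -rmorphB.
rewrite tofrac_eq0 subr_eq0 eq_sym; apply/eqP => E.
have := congr1 (size : {poly rat} -> nat) E.
by rewrite size_polyXn size_poly1; lia.
Qed.

Lemma q14_neq0 : q14 != 0.
Proof. by rewrite /q14 tofrac_eq0 polyX_eq0. Qed.

(** Starting from b = 0 at L = 0, each step of the recursion adds k - 2i with 0 <= i <= k to b. *)
Lemma f_eq0 (k L : nat) (b c : int) :
  (forall M : nat, b <> L%:Z * k%:Z - 2 * M%:Z) -> f k L b c = 0.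
Proof.
elim: L b c => [|L IH] b c bM /=; case: ifP => // _.
  by case: eqP => // b0; case: (bM 0%N); rewrite b0; lia.
rewrite /predecessors /steps !big_map big1 // => i _.
rewrite IH ?mul0r // => M E; apply: (bM (M + i)%N).
by lia.
Qed.

(* 4 times the part of the exponent that depends on x only through            *)
(* M = \sum_a a x_a.                                                          *)
Definition exponent0 (k L h M : nat) : int :=
  L%:Z ^+ 2 * k%:Z - L%:Z * k%:Z + 2 * L%:Z * h%:Z - 2 * M%:Z - 4 * L%:Z * M%:Z.

Lemma weakly_admissibleI (k h : nat) (b c : int) : (h <= k)%N ->
  c = b + 2 * h%:Z - k%:Z -> weakly_admissible k b c.
Proof.
move=> hk ->; apply/mapP; exists (k - h)%N; first by rewrite mem_iota; lia.
by lia.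
Qed.

Lemma f_coef (k L h M : nat) (b c : int) : (h <= k)%N ->
  b = L%:Z * k%:Z - 2 * M%:Z -> c = b + 2 * h%:Z - k%:Z ->
  f k L b c = q14 ^ exponent0 k L h M
     * (qnsum q k L 'X (fun j => h < j <= k)%N)`_M.
Proof.
elim: L h M b c => [|L IH] h M b c hk bE cE.
  rewrite /= (weakly_admissibleI hk cE) qnsum_l0 coef1.
  rewrite (_ : (b == 0) = (M == 0%N)); last by lia.
  case: eqP => [M0|_]; last by rewrite mulr0.
  by rewrite (_ : exponent0 k 0 h M = 0) ?mul1r // /exponent0 M0; ring.
rewrite /= (weakly_admissibleI hk cE) /predecessors /steps !big_map.
rewrite -[iota 0 k.+1]/(index_iota 0 k.+1).
rewrite big_mkord (coef_qnsum_rec oneB_q_neq0) // mulr_sumr [RHS]big_mkcond /=.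
apply: eq_bigr => a _; have ak : (a <= k)%N by rewrite -ltnS.
case: leqP => aM; last first.
  by rewrite f_eq0 ?mul0r // => M' E; nia.
rewrite (IH (k - a)%N (M - a)%N); [|lia|lia|lia].
rewrite mulrAC [RHS]mulrA; congr (_ * _).
rewrite (_ : q ^+ _ = q14 ^ (4 * (M + L.+1 * (a - h)))%N%:Z); last first.
  by rewrite -exprnP exprM.
rewrite -!expfzDr ?q14_neq0 //; congr (_ ^ _).
(* |a - h| / 2 is (a - h)^+ minus the linear term (a - h) / 2, which the change in [exponent0]
   absorbs. *)
rewrite /exponent0 -!subzn // !(PoszM, PoszD).
have -> : `|b + (- k%:Z + 2 * a%:Z) - c| = 2 * ((a - h)%N%:Z + (h - a)%N%:Z).
  by lia.
rewrite (_ : h%:Z = a%:Z + (h - a)%N%:Z - (a - h)%N%:Z); last by lia.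
by rewrite -[L.+1]addn1 PoszD; ring.
Qed.

(* Since the x_a sum to L, each is at most L, so x ranges over 'I_L.+1-valued *)
(* finite functions. The condition \sum_a a x_a = (L k - b) / 2 is doubled.   *)
Theorem theorem3 (k L : nat) (b c : int) (hk : (1 <= k)%N)
    (hbc : weakly_admissible k b c) :
  f k L b c =
  \sum_(x : {ffun 'I_k.+1 -> 'I_L.+1}
        | (\sum_(a < k.+1) x a == L)%N
          && (2 * (\sum_(a < k.+1) a * x a)%N%:Z == L%:Z * k%:Z - b))
    q14 ^ exponent4 L b c (fun a => x a) * qmultinomial L (fun a => x a).
Proof.
have [h hk' cE] : exists2 h : nat, (h <= k)%N & c = b + 2 * h%:Z - k%:Z.
  move: hbc => /mapP[i]; rewrite mem_iota => ik E; exists (k - i)%N; lia.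
(* This one equation tests that L k - b is both even and non-negative; otherwise both sides are
   0. *)
have [bM|bM] := altP (2 * `|((L%:Z * k%:Z - b) %/ 2)%Z|%:Z =P L%:Z * k%:Z - b);
  last first.
  rewrite f_eq0 => [|M bE]; last first.
    by move: bM; rewrite bE opprB addrC subrK mulKz // absz_nat eqxx.
  rewrite big_pred0 // => x; apply/negP => /andP[_ /eqP mE].
  by move: bM; rewrite -mE mulKz // absz_nat eqxx.
set M := `|_|%N in bM.
rewrite (@f_coef k L h M) //; last by lia.
rewrite (qnsum_expand oneB_q_neq0 _ _ (leqnn L)) coef_sum mulr_sumr.
rewrite [RHS]big_mkcondr /=; apply: eq_bigr => x /eqP xL.
rewrite coefZ coefXn -bM (inj_eq (@mulfI int 2 isT)) eqz_nat eq_sym.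
case: eqP => [ME|_]; last by rewrite !mulr0.
rewrite mulr1 (mulrA (q14 ^ _)) /qmultinomial xL eqxx; congr (_ * _).
rewrite (@exponent4E _ _ h) //; [|by lia|by rewrite ME].
rewrite ME -/(exponent0 k L h M) [RHS]expfzDr ?q14_neq0 //; congr (_ * _).
by rewrite -[4]/(Posz 4) -PoszM -exprnP exprM.
Qed.
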